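(* (1) For every $2$-edge coloring $c:[\mathbb{N}]^2\to\{0,1\}$ of the complete graph $K_{\mathbb{N}}$, the vertex set $\mathbb{N}$ can be partitioned into at most $4$ monochromatic squares of paths. (2) There is a $2$-edge coloring of $K_{\mathbb{N}}$ such that $\mathbb{N}$ cannot be partitioned into $3$ (pairwise disjoint) monochromatic squares of paths.
   Context: A square of a path (second power of a path) is a finite or one-way infinite sequence $v_0,v_1,\dots$ of distinct vertices such that $\{v_i,v_j\}$ is an edge whenever $1\le|i-j|\le 2$; it is monochromatic of color $i$ if all these edges have color $i$. The empty set and single vertices count as monochromatic squares of paths in any color. *)

(* Defs.v *)
From mathcomp Require Import all_boot.
From mathcomp Require Import classical_sets.

Set Implicit Arguments.
Unset Strict Implicit.
Unset Printing Implicit Defensive.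

Local Open Scope classical_set_scope.

(* A 2-edge colouring of the complete graph on nat is a [c : rel nat] with
   [symmetric c]: false and true stand for the colours 0 and 1, and the values
   on the diagonal are never used, since the sequences below are injective. *)

Inductive vertex_sequence :=
  | FiniteSeq of seq nat
  | InfiniteSeq of (nat -> nat).

Definition vertices (p : vertex_sequence) : set nat :=
  match p with
  | FiniteSeq s => [set x | x \in s]
  | InfiniteSeq f => range f
  end.

(* The adjacency condition is stated for i < j only, as the graphs it is used
   with are symmetric. *)
Definition square_of_path (e : rel nat) (p : vertex_sequence) : Prop :=
  match p with
  | FiniteSeq s =>
      uniq s /\
      forall i j, i < j <= i + 2 -> j < size s -> e (nth 0 s i) (nth 0 s j)
  | InfiniteSeq f =>
      injective f /\ forall i j, i < j <= i + 2 -> e (f i) (f j)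
  end.

Definition monochromatic_square (c : rel nat) (color : bool)
    (p : vertex_sequence) : Prop :=
  square_of_path [rel x y | c x y == color] p.

(* Parts may be empty (the empty sequence is a square of a path) and distinct
   parts may have distinct colours. *)
Definition partitioned_into_squares (c : rel nat) (k : nat) : Prop :=
  exists P : 'I_k -> vertex_sequence,
    [/\ forall i, exists color, monochromatic_square c color (P i),
        trivIset setT (vertices \o P)
      & \bigcup_i vertices (P i) = setT].

(* Main.v *)
Require Import Defs.
From mathcomp Require Import all_boot zify.
From mathcomp Require Import boolp classical_sets cardinality filter.

(** (1) Fix a nonprincipal ultrafilter U; every vertex v has a limit colour, the
    colour of U-almost all edges at v. If U contains the class of limit colour
    i, this class is covered by one square of colour i, since any two of its
    vertices can be linked through U-generic vertices. Let j be the other colour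
    and V the class of limit colour j. Any path of colour j in V becomes a square
    of colour j by inserting a U-generic vertex after every second vertex.
    If V is finite, it is partitioned into two paths of colour j and one square
    of colour i. If V is infinite, take a nonprincipal ultrafilter W containing
    V; only the vertices of V with W-limit i remain a problem. If W contains the
    class of W-limit i, this class is covered by a square of colour i, and the
    other vertices of V are linked through W-generic vertices of V into a path of
    colour j. Otherwise, the class of W-limit j is covered by one square of
    colour j, and the set Y of vertices with U-limit j and W-limit i is
    partitioned into a path of colour j and a path of colour i, which U and W
    turn into squares; for infinite Y this uses a third ultrafilter containing Y.
    All squares are built simultaneously, one vertex at a time.

    (2) Split nat into blocks of sizes 5, 3, 1 and infinity. Edges inside the
    first two blocks have colour 1, edges inside the infinite block colour 0,
    edges between the infinite block and the rest colour 1, all other edges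
    colour 0. An infinite monochromatic square lies in the infinite block, so
    two squares would have to cover the nine other vertices. Restricted to these
    nine vertices, a square of colour 1 is a path of colour 1, hence lies in one
    block, and a square of colour 0 contains few vertices of the first two
    blocks. *)

Set Implicit Arguments.
Unset Strict Implicit.
Unset Printing Implicit Defensive.

Local Open Scope classical_set_scope.

(** * Squares as lists *)

Fixpoint square (T : Type) (e : rel T) (s : seq T) : bool :=
  if s is x :: s' then all (e x) (take 2 s') && square e s' else true.

Lemma square_nth (T : Type) (x0 : T) (e : rel T) (s : seq T) (i j : nat) :
  square e s -> i < j <= i + 2 -> j < size s -> e (nth x0 s i) (nth x0 s j).
Proof.
elim: s i j => [|x s IHs] [|i] [|j] //=; last first.
  by move=> /andP[_ sq_s] ij js; apply: IHs => //; lia.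
by case: s {IHs} => [|y [|z s]] //=; case: j => [|[|j]] //=;
  rewrite ?andbT ?take0 /=; lia.
Qed.

Lemma nth_square (T : Type) (x0 : T) (e : rel T) (s : seq T) :
  (forall i j, i < j <= i + 2 -> j < size s -> e (nth x0 s i) (nth x0 s j)) ->
  square e s.
Proof.
elim: s => //= x s IHs es; apply/andP; split; last first.
  by apply: IHs => i j ij js; apply: (es i.+1 j.+1); lia.
case: s {IHs} es => [|y [|z s]] //= es; first by rewrite andbT (es 0 1).
by rewrite take0 /= andbT (es 0 1) // (es 0 2).
Qed.

Lemma square_rev_nth (T : Type) (x0 : T) (e : rel T) (s : seq T) (i j : nat) :
  symmetric e -> square e s -> i < j <= i + 2 -> j < size s ->
  e (nth x0 (rev s) i) (nth x0 (rev s) j).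
Proof.
move=> sym_e sq_s ij js; rewrite !nth_rev //; last by lia.
by rewrite sym_e; apply: square_nth => //; lia.
Qed.

(** * Partitions of finite vertex lists into paths and squares *)

Lemma sorted_join (T : Type) (e : rel T) (x : T) (p q : seq T) :
  symmetric e -> path e x p -> path e x q -> sorted e (rev p ++ x :: q).
Proof.
move=> sym_e xp xq; rewrite sorted_cat_cons xq andbT -rev_cons rev_sorted.
by rewrite (@eq_sorted _ _ e) // => y z; rewrite sym_e.
Qed.

Ltac perm_count :=
  apply/permP => ?; do 4 rewrite ?(count_cat, count_rev) /=; clear; lia.

(* Paths and square are stacks with tops p, q and b; unless v can be placed
   directly, the top of S moves to a path, or v is placed and the top of S
   becomes the vertex to place. *)
Lemma two_paths_square_step (T : eqType) (red blue : rel T) (v : T)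
    (P Q S : seq T) :
  symmetric red -> symmetric blue -> (forall x y, blue x y = ~~ red x y) ->
  sorted red P -> sorted red Q -> square blue S ->
  exists P' Q' S', [/\ sorted red P', sorted red Q', square blue S'
    & perm_eq (P' ++ Q' ++ S') (v :: P ++ Q ++ S)].
Proof.
move=> symr symb blueE; have [n] := ubnP (size S).
elim: n => // n IHn in v P Q S *; rewrite ltnS => leSn.
case: P => [|p P] redP redQ blueS.
  by exists [:: v], Q, S; split=> //; perm_count.
case: Q => [|q Q] in redQ *.
  by exists (p :: P), [:: v], S; split=> //; perm_count.
case vp: (red v p).
  by exists (v :: p :: P), (q :: Q), S; split; rewrite //= ?vp //; perm_count.
case vq: (red v q).
  by exists (p :: P), (v :: q :: Q), S; split; rewrite //= ?vq //; perm_count.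
case pq: (red p q).
  exists (rev P ++ p :: q :: Q), [:: v], S; split=> //; last by perm_count.
  by apply: (sorted_join symr) => //=; rewrite pq.
case: S => [|b S] in leSn blueS *.
  exists P, Q, [:: v; p; q]; split; rewrite /= ?blueE ?vp ?vq ?pq //.
  - exact: path_sorted redP.
  - exact: path_sorted redQ.
  - by perm_count.
have /andP[_ blueS'] := blueS.
case bp: (red b p).
  have [|//|//|P' [Q' [S' [rP rQ bS perm]]]] :=
    IHn v (b :: p :: P) (q :: Q) S leSn; first by rewrite /= bp.
  by exists P', Q', S'; split=> //; apply: (perm_trans perm); perm_count.
case bq: (red b q).
  have [//||//|P' [Q' [S' [rP rQ bS perm]]]] :=
    IHn v (p :: P) (b :: q :: Q) S leSn; first by rewrite /= bq.
  by exists P', Q', S'; split=> //; apply: (perm_trans perm); perm_count.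
have rP : sorted red P by exact: path_sorted redP.
have rQ : sorted red Q by exact: path_sorted redQ.
have bluepb : blue p b by rewrite symb blueE bp.
have blueqb : blue q b by rewrite symb blueE bq.
have bluepq : blue p q by rewrite blueE pq.
have blueqp : blue q p by rewrite symb.
have bluevp : blue v p by rewrite blueE vp.
have bluevq : blue v q by rewrite blueE vq.
case: S => [|a S] in leSn blueS blueS' *.
  exists P, Q, [:: v; p; q; b]; split=> //; last by perm_count.
  by rewrite /= bluevp bluevq bluepq bluepb blueqb.
(* Now [v], [p], [q] are pairwise blue, and [b] is blue to [p] and [q]. If [a] is blue to [p] or
   [q], all three enter the square, that one next to [b]. *)
case ap: (red a p); last first.
  exists P, Q, [:: v, q, p, b, a & S]; split=> //; last by perm_count.
  by rewrite /= bluevq bluevp blueqp blueqb bluepb (symb p a) (blueE a p) ap take0.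
case aq: (red a q); last first.
  exists P, Q, [:: v, p, q, b, a & S]; split=> //; last by perm_count.
  by rewrite /= bluevq bluevp bluepq blueqb bluepb (symb q a) (blueE a q) aq take0.
have /andP[_ blueS''] := blueS'.
(* Being red to [p] and [q], [a] can merge the two paths, which frees a path for [b] and [v]. *)
case bv: (red b v).
  exists (rev (p :: P) ++ a :: q :: Q), [:: b; v], S; split=> //.
  - by apply: (sorted_join symr) => //=; rewrite ?ap ?aq.
  - by rewrite /= bv.
  - by perm_count.
case av: (red a v).
  have [||//|//|P' [Q' [S' [rP' rQ' bS perm]]]] :=
    IHn b [:: v, a, p & P] (q :: Q) S; first exact: ltnW.
    by rewrite /= symr av ap.
  by exists P', Q', S'; split=> //; apply: (perm_trans perm); perm_count.
exists (p :: P), (q :: Q), [:: v, b, a & S]; split=> //; last by perm_count.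
by rewrite /= (symb v b) (symb v a) (blueE b v) (blueE a v) bv av take0.
Qed.

Lemma two_paths_square (T : eqType) (red blue : rel T) (L : seq T) :
  symmetric red -> symmetric blue -> (forall x y, blue x y = ~~ red x y) ->
  exists P Q S, [/\ sorted red P, sorted red Q, square blue S
    & perm_eq (P ++ Q ++ S) L].
Proof.
move=> symr symb blueE.
elim: L => [|v L [P [Q [S [rP rQ bS perm]]]]]; first by exists [::], [::], [::].
have [P' [Q' [S' [rP' rQ' bS' perm']]]] :=
  two_paths_square_step v symr symb blueE rP rQ bS.
by exists P', Q', S'; split=> //; rewrite (perm_trans perm') // perm_cons.
Qed.

(** If [v] fits on neither path, the colour of the edge between the tops [p] and [q] decides which
    top changes path, followed by [v]. *)
Lemma two_paths (T : eqType) (red blue : rel T) (L : seq T) :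
  symmetric red -> symmetric blue -> (forall x y, blue x y = ~~ red x y) ->
  exists P Q, [/\ sorted red P, sorted blue Q & perm_eq (P ++ Q) L].
Proof.
move=> symr symb blueE.
elim: L => [|v L [P [Q [rP bQ perm]]]]; first by exists [::], [::].
suff [P' [Q' [rP' bQ' perm']]] : exists P' Q',
    [/\ sorted red P', sorted blue Q' & perm_eq (P' ++ Q') (v :: P ++ Q)].
  by exists P', Q'; split=> //; rewrite (perm_trans perm') // perm_cons.
case: P Q => [|p P] [|q Q] in rP bQ {perm} *.
- by exists [:: v], [::].
- by exists [:: v], (q :: Q).
- by exists (p :: P), [:: v]; split=> //; perm_count.
case vp: (red v p).
  by exists (v :: p :: P), (q :: Q); split=> //=; rewrite vp.
case vq: (red v q); last first.
  exists (p :: P), (v :: q :: Q); split=> //; last by perm_count.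
  by rewrite /= blueE vq.
case pq: (red q p).
  exists [:: v, q, p & P], Q; split; last by perm_count.
    by rewrite /= vq pq.
  exact: path_sorted bQ.
exists P, [:: v, p, q & Q]; split; last by perm_count.
  exact: path_sorted rP.
by rewrite /= blueE vp symb blueE pq.
Qed.

(** * Nonprincipal ultrafilters and limit colours *)

Definition mono (c : rel nat) (b : bool) : rel nat := [rel x y | c x y == b].

Lemma symmetric_mono (c : rel nat) (b : bool) : symmetric c -> symmetric (mono c b).
Proof. by move=> symc x y; rewrite /mono /= symc. Qed.

Definition nonprincipal (U : set_system nat) : Prop :=
  UltraFilter U /\ forall s : seq nat, U [set x | x \notin s].

(** As [A] is infinite, [A] and the cofinite sets generate a proper filter. *)
Lemma nonprincipal_extending (A : set nat) :
  infinite_set A -> exists2 U, nonprincipal U & U A.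
Proof.
move=> infA.
pose F : set_system nat :=
  [set B | exists s : seq nat, A `&` [set x | x \notin s] `<=` B].
have fF : ProperFilter F.
  split.
    move=> [s sub]; apply: infA; apply: (@sub_finite_set _ _ [set` s]) => //.
    by move=> x Ax; apply/negPn/negP => xs; apply: (sub x).
  split; first by exists [::].
    move=> B C [s sB] [t tC]; exists (s ++ t) => x [Ax].
    by rewrite /= mem_cat negb_or => /andP[xs xt]; split; [apply: sB|apply: tC].
  by move=> B C BC [s sB]; exists s => x /sB /BC.
have [U [ultraU FU]] := ultraFilterLemma fF.
exists U; last by apply: FU; exists [::] => x [].
by split=> // s; apply: FU; exists s => x [].
Qed.

Lemma nonprincipalI (U : set_system nat) (A B : set nat) :
  nonprincipal U -> U A -> U B -> U (A `&` B).
Proof. by case=> ultraU _; apply: filterI. Qed.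

Lemma nonprincipalS (U : set_system nat) (A B : set nat) :
  nonprincipal U -> A `<=` B -> U A -> U B.
Proof. by case=> ultraU _; apply: filterS. Qed.

Lemma nonprincipal_bool (U : set_system nat) (f : nat -> bool) :
  nonprincipal U -> exists b, U [set x | f x == b].
Proof.
case=> ultraU _; have [Uf|Uf] := in_ultra_setVsetC [set x | f x == true] ultraU.
  by exists true.
by exists false; apply: filterS Uf => x /=; case: (f x).
Qed.

Definition limcolor (c : rel nat) (U : set_system nat) (v : nat) : bool :=
  `[< U [set x | c v x == true] >].

Lemma limcolorP (c : rel nat) (U : set_system nat) (v : nat) :
  nonprincipal U -> U [set x | c v x == limcolor c U v].
Proof.
move=> npU; rewrite /limcolor; case: asboolP => // nU.
by have [[]] := nonprincipal_bool (c v) npU.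
Qed.

(** All the conditions define members of [U], so finitely many of them hold together. *)
Lemma generic_vertex (c : rel nat) (U : set_system nat) (b : bool) (A : set nat)
    (vs F : seq nat) :
  nonprincipal U -> U A -> all (fun v => limcolor c U v == b) vs ->
  exists x, [/\ A x, x \notin F & all (fun v => mono c b v x) vs].
Proof.
move=> npU; elim: vs A => [|v vs IHvs] A UA /=.
  move=> _; have UAF := nonprincipalI npU UA (npU.2 F).
  by have := npU.1; move=> ?; have [x [Ax Fx]] := filter_ex UAF; exists x.
move=> /andP[/eqP vb vsb]; have := limcolorP c v npU; rewrite vb => Uv.
have [x [[Ax vx] xF allx]] := IHvs _ (nonprincipalI npU UA Uv) vsb.
by exists x; split=> //; apply/andP.
Qed.

(* The path v1 v2 v3 v4 ... becomes the square v1 v2 a v3 v4 a' ... *)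
Lemma path_to_square (c : rel nat) (U : set_system nat) (b : bool)
    (F p : seq nat) :
  symmetric c -> nonprincipal U -> all (fun v => limcolor c U v == b) p ->
  sorted (mono c b) p -> uniq p -> {subset p <= F} ->
  exists s, [/\ square (mono c b) s, take 2 s = take 2 p, {subset p <= s},
    uniq s & forall x, x \in s -> x \in p \/ x \notin F].
Proof.
move=> symc npU; have [n] := ubnP (size p).
elim: n => // n IHn in p *; rewrite ltnS.
case: p => [|v1 [|v2 p]] sz limp path_p uniq_p pF.
- by exists [::]; split.
- by exists [:: v1]; split=> // x; left.
have [|||||s [sq_s s2 sub_s uniq_s newF]] := IHn p.
- exact: ltnW.
- by move: limp => /= /and3P[].
- by move: path_p => /= /andP[_ /path_sorted].
- by move: uniq_p => /= /and3P[].
- by move=> x xp; apply: pF; rewrite !inE xp !orbT.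
have [||a [_]] := @generic_vertex c U b setT (v1 :: v2 :: take 2 s) (F ++ s) npU.
- exact: nonprincipalS (npU.2 [::]).
(* [s] starts like [p], so its first two vertices have limit colour [b]. *)
- rewrite s2; move: limp => /= /and3P[-> -> /=]; rewrite -{1}(cat_take_drop 2 p).
  by rewrite all_cat => /andP[].
rewrite mem_cat negb_or => /andP[aF a_s] /= /and3P[v1a v2a all_a].
have inF x : x \in [:: v1, v2 & p] -> x != a.
  by move=> /pF xF; apply: contraNneq aF => <-.
have not_s x : x \in F -> x \notin p -> x \notin s.
  by move=> xF xp; apply/negP => /newF []; [exact/negP|rewrite xF].
move: (uniq_p) => /=; rewrite inE negb_or => /and3P[/andP[v12 v1p] v2p uniq_p'].
exists [:: v1, v2, a & s]; split=> //.
- have /= /andP[v1v2 path_v2] := path_p.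
  rewrite /= take0 v1v2 v1a v2a sq_s /= ?andbT; apply/andP; split.
    case: s p s2 path_v2 {IHn sz limp path_p uniq_p pF sq_s sub_s uniq_s newF
      a_s all_a inF not_s v1p v2p uniq_p'} => [|y s] [|z p] //= [-> _].
    by rewrite take0 /= andbT => /andP[].
  by apply: sub_all all_a => x; rewrite symmetric_mono.
- by rewrite /= !take0.
- by move=> x; rewrite !inE => /or3P[->|->|/sub_s ->]; rewrite ?orbT.
- rewrite /= !inE !negb_or v12 uniq_s a_s !inF ?inE ?eqxx ?orbT //=.
  by rewrite !not_s ?pF ?inE ?eqxx ?orbT.
- move=> x; rewrite !inE => /or4P[/eqP->|/eqP->|/eqP->|/newF[xp|xF]].
  + by left; rewrite eqxx.
  + by left; rewrite eqxx orbT.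
  + by right.
  + by left; rewrite xp !orbT.
  + by right.
Qed.

(** * Squares that grow vertex by vertex *)

(* Sequences under construction are stored with their last vertex first. *)
Record growing_square (c : rel nat) := GrowingSquare {
  color : bool;
  start : seq nat;
  good : seq nat -> Prop;
  target : nat -> Prop;
  good_start : good start;
  good_square : forall s, good s -> square (mono c color) s;
  grow : forall (s F : seq nat) (v : nat), good s -> target v ->
    {subset s <= F} -> v \notin F ->
    exists t, [/\ good (t ++ s), v \in t, uniq t & {in t, forall x, x \notin F}]
}.

(** Without targets it never grows; finished squares can thus join the common construction. *)
Definition fixed_square (c : rel nat) (b : bool) (s : seq nat)
  (sq_s : square (mono c b) s) : growing_square c.
Proof.
by exists b s (fun s' => s' = s) (fun=> False) => // s' ->.
Defined.

(* A square  ... y w  is continued to  ... y w a x v : here x is W-generic and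
   thus adjacent to w and v, and then a is U-generic and adjacent to y, w, x, v.
   The vertex a must come last in the choice, as x is known only to have the
   right limit colour with respect to U. *)
Definition generic_square (c : rel nat) (U W : set_system nat) (b : bool)
  (symc : symmetric c) (npU : nonprincipal U) (npW : nonprincipal W)
  (WU : W [set x | limcolor c U x == b]) : growing_square c.
Proof.
exists b [::]
  (fun s => [/\ square (mono c b) s,
     all (fun v => limcolor c U v == b) (take 2 s)
   & all (fun v => limcolor c W v == b) (take 1 s)])
  (fun v => limcolor c U v == b /\ limcolor c W v == b) => //; first by move=> s [].
move=> s F v [sq_s Us Ws] [Uv Wv] sF vF.
have [|x [Ux xvF]] := @generic_vertex c W b _ (v :: take 1 s) (v :: F) npW WU.
  by rewrite /= Wv.
rewrite inE negb_or in xvF; have /andP[xv xF] := xvF.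
move=> /= /andP[vx xs].
have [||a [_ aF]] :=
  @generic_vertex c U b setT [:: v, x & take 2 s] [:: v, x & F] npU.
- exact: nonprincipalS (npU.2 [::]).
- by rewrite /= Uv Us andbT.
move: aF; rewrite !inE !negb_or => /and3P[av ax aF] /= /and3P[va xa as_].
exists [:: v; x; a]; split.
- split=> /=; last 2 first.
  + by rewrite Uv /= andbT.
  + by rewrite Wv.
  rewrite vx va xa sq_s take0 /= andbT; apply/andP; split.
    by apply: sub_all xs => y; rewrite symmetric_mono.
  by apply: sub_all as_ => y; rewrite symmetric_mono.
- by rewrite inE eqxx.
- by rewrite /= !inE !negb_or eq_sym xv eq_sym av eq_sym ax.
- by move=> y; rewrite !inE => /or3P[] /eqP->.
Defined.

(** If the lengths are unbounded, entry [m] of the limit is read off any list longer than [m];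
    otherwise a longest list is already the limit. *)
Lemma limit_square (e : rel nat) (u : nat -> seq nat) :
  (forall n, exists t, u n.+1 = u n ++ t) -> (forall n, uniq (u n)) ->
  (forall n i j, i < j <= i + 2 -> j < size (u n) ->
     e (nth 0 (u n) i) (nth 0 (u n) j)) ->
  exists p, square_of_path e p /\ forall x, vertices p x <-> exists n, x \in u n.
Proof.
move=> ext uniq_u sq_u.
have extD n m : n <= m -> exists t, u m = u n ++ t.
  move=> /subnK <-; elim: (m - n) => [|d [t IHd]]; first by exists [::]; rewrite cats0.
  by have [t' ->] := ext (d + n); exists (t ++ t'); rewrite IHd catA.
have nthE n m i : i < size (u n) -> i < size (u m) -> nth 0 (u n) i = nth 0 (u m) i.
  move=> lin lim; have [/extD[t E]|/ltnW/extD[t E]] := leqP n m.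
    by rewrite E nth_cat lin.
  by rewrite E nth_cat lim.
have [unb|bnd] := pselect (forall m, exists n, m < size (u n)).
  have [N NP] := choice unb.
  pose f m := nth 0 (u (N m)) m.
  have fE m n : m < size (u n) -> f m = nth 0 (u n) m by move=> mn; apply: nthE.
  exists (InfiniteSeq f); split; last first.
    move=> x; split=> [[m _ <-]|[n xn]].
      by exists (N m); apply: mem_nth.
    exists (index x (u n)) => //.
    by rewrite (fE _ n) ?index_mem // nth_index.
  split=> [i j|i j ij].
    have lt k : k <= maxn i j -> k < size (u (N (maxn i j))).
      by move=> le; apply: leq_ltn_trans le (NP _).
    rewrite !(fE _ (N (maxn i j))) ?lt ?leq_maxl ?leq_maxr // => /eqP.
    by rewrite nth_uniq ?lt ?leq_maxl ?leq_maxr // => /eqP.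
  rewrite (fE i (N j)) ?(fE j (N j)) ?NP //; first exact: sq_u.
  by apply: leq_trans (NP j); case/andP: ij => /ltnW; rewrite ltnS.
have [m mP] : exists m, forall n, size (u n) <= m.
  move: bnd => /existsNP[m mP]; exists m => n; rewrite leqNgt; apply/negP => lt.
  by apply: mP; exists n.
have exP : exists k, `[< exists n, size (u n) = k >].
  by exists (size (u 0)); apply/asboolP; exists 0.
have leP k : `[< exists n, size (u n) = k >] -> k <= m.
  by move=> /asboolP[n <-].
have [k /asboolP[N Nk] kmax] := ex_maxnP exP leP.
exists (FiniteSeq (u N)); split=> [|x]; first by split=> // i j; apply: sq_u.
split=> [xN|[n xn]]; first by exists N.
have [/extD[t E]|/ltnW/extD[t E]] := leqP n N; first by rewrite /= E mem_cat xn.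
have /kmax : `[< exists m, size (u m) = size (u n) >] by apply/asboolP; exists n.
rewrite -Nk E size_cat -[leqRHS]addn0 leq_add2l leqn0 size_eq0 => /eqP t0.
by rewrite /= -[u N]cats0 -t0 -E.
Qed.

Lemma growing_squares_partition (c : rel nat) (k : nat)
    (g : 'I_k -> growing_square c) :
  symmetric c -> (forall i, uniq (start (g i))) ->
  (forall i j x, x \in start (g i) -> x \in start (g j) -> i = j) ->
  (forall v, exists i, v \in start (g i) \/ target (g i) v) ->
  partitioned_into_squares c k.
Proof.
move=> symc uniq_start disj_start cover.
pose inv (st : 'I_k -> seq nat) :=
  [/\ forall i, good (g i) (st i), forall i, uniq (st i),
      forall i j x, x \in st i -> x \in st j -> i = j
    & forall i, {subset start (g i) <= st i}].
(* The invariant is assumed inside the existential, so that every state has a successor and [choice]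
   applies. *)
have step (stv : ('I_k -> seq nat) * nat) : exists st' : 'I_k -> seq nat,
    inv stv.1 -> [/\ inv st', forall i, exists t, st' i = t ++ stv.1 i
      & exists i, stv.2 \in st' i].
  case: stv => st v /=; have [Ist|nI] := pselect (inv st); last by exists st.
  have [good_st uniq_st disj_st start_st] := Ist.
  have [[i vi]|vst] := pselect (exists i, v \in st i).
    exists st => _; split=> //; last by exists i.
    by move=> i'; exists [::].
  have [i [vi|vi]] := cover v; first by case: vst; exists i; apply: start_st.
  pose F := flatten [seq st j | j : 'I_k].
  have stF j : {subset st j <= F}.
    by move=> x xj; apply/flatten_mapP; exists j; rewrite ?mem_enum.
  have vF : v \notin F.
    by apply/negP => /flatten_mapP[j _ vj]; apply: vst; exists j.
  have [t [good_t vt uniq_t tF]] := grow (good_st i) vi (stF i) vF.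
  pose st' j := if j == i then t ++ st i else st j.
  have sub j : {subset st j <= st' j}.
    by move=> x; rewrite /st'; case: eqP => // ->; rewrite mem_cat => ->; rewrite orbT.
  have mem_st' j x : x \in st' j -> x \in st j \/ j = i /\ x \in t.
    rewrite /st'; case: eqP => [->|_]; last by left.
    by rewrite mem_cat => /orP[]; [right|left].
  exists st' => _; split.
  - split.
    + by move=> j; rewrite /st'; case: eqP => [->|].
    + move=> j; rewrite /st'; case: eqP => // _.
      rewrite cat_uniq uniq_t uniq_st andbT; apply/hasPn => x xi.
      by apply/negP => /tF; rewrite (stF i).
    + move=> j j' x /mem_st'[xj|[-> xt]] /mem_st'[xj'|[-> xt']] //.
      * exact: disj_st xj xj'.
      * by have := tF x xt'; rewrite (stF j).
      * by have := tF x xt; rewrite (stF j').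
    + by move=> j x /start_st /sub.
  - move=> j; rewrite /st'; case: eqP => [->|_]; first by exists t.
    by exists [::].
  - by exists i; rewrite /st' eqxx mem_cat vt.
have [f fP] := choice step.
pose st := fix st n : 'I_k -> seq nat :=
  if n is m.+1 then f (st m, m) else fun i => start (g i).
have invst n : inv (st n).
  elim: n => [|n IHn] /=; last by have [] := fP (st n, n) IHn.
  by split=> // i; first exact: good_start.
have ext n i : exists t, st n.+1 i = t ++ st n i.
  by have [_ ext _] := fP (st n, n) (invst n); apply: ext.
have mono_st n m i : n <= m -> {subset st n i <= st m i}.
  move=> /subnK <-; elim: (m - n) => // d IHd x /IHd.
  by rewrite addSn; have [t ->] := ext (d + n) i; rewrite mem_cat => ->; rewrite orbT.
have limit i : exists p, square_of_path (mono c (color (g i))) p /\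
    forall x, vertices p x <-> exists n, x \in st n i.
  (* Lists grow at their heads, so their reversals are successive prefixes. *)
  have [n|n|n a b ab|p [sq_p pP]] :=
    @limit_square (mono c (color (g i))) (fun n => rev (st n i)).
  - by have [t ->] := ext n i; exists (rev t); rewrite rev_cat.
  - by rewrite rev_uniq; have [_] := invst n.
  - rewrite size_rev; apply: square_rev_nth ab; first exact: symmetric_mono.
    by apply: good_square; have [] := invst n.
  exists p; split=> // x; rewrite pP.
  by split=> -[n]; rewrite ?mem_rev => xn; exists n; rewrite ?mem_rev.
have [P PP] := choice limit.
exists P; split.
- by move=> i; exists (color (g i)); have [] := PP i.
- move=> i j _ _ [x [/= /(PP i).2[n xn] /(PP j).2[m xm]]].
  have [_ _ disj _] := invst (maxn n m).
  by apply: disj (mono_st _ _ _ (leq_maxl n m) _ xn) (mono_st _ _ _ (leq_maxr n m) _ xm).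
- rewrite eqEsubset; split=> // x _.
  have [_ _ [i xi]] := fP (st x, x) (invst x).
  by exists i => //; apply/(PP i).2; exists x.+1.
Qed.

Lemma four_growing_squares (c : rel nat) (g1 g2 g3 g4 : growing_square c) :
  symmetric c ->
  uniq (start g1 ++ start g2 ++ start g3 ++ start g4) ->
  (forall v, [\/ v \in start g1 ++ start g2 ++ start g3 ++ start g4,
     target g1 v \/ target g2 v | target g3 v \/ target g4 v]) ->
  partitioned_into_squares c 4.
Proof.
move=> symc uniq_g cover.
pose g := tnth [tuple g1; g2; g3; g4].
have gE i : g i = nth g1 [:: g1; g2; g3; g4] i by rewrite /g (tnth_nth g1).
move: uniq_g; rewrite !cat_uniq !has_cat !negb_or => /and5P[u1 /and3P[d12 d13 d14] u2].
move=> /andP[d23 d24] /and3P[u3 d34 u4].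
have disj (s t : seq nat) x : ~~ has [in s] t -> x \in s -> x \in t -> False.
  by move=> /hasPn st xs /st; rewrite /= xs.
apply: (@growing_squares_partition c 4 g symc).
- by move=> i; rewrite gE; case: i => [[|[|[|[|i]]]]].
- move=> i j x; rewrite !gE.
  case: i j => [[|[|[|[|i]]]] ?] [[|[|[|[|j]]]] ?] //= xi xj;
  first [exact: val_inj | exfalso];
  first [exact: (disj _ _ _ d12 xi xj) | exact: (disj _ _ _ d12 xj xi)
    | exact: (disj _ _ _ d13 xi xj) | exact: (disj _ _ _ d13 xj xi)
    | exact: (disj _ _ _ d14 xi xj) | exact: (disj _ _ _ d14 xj xi)
    | exact: (disj _ _ _ d23 xi xj) | exact: (disj _ _ _ d23 xj xi)
    | exact: (disj _ _ _ d24 xi xj) | exact: (disj _ _ _ d24 xj xi)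
    | exact: (disj _ _ _ d34 xi xj) | exact: (disj _ _ _ d34 xj xi)].
- move=> v; have [i gi] : exists i, v \in start (nth g1 [:: g1; g2; g3; g4] i)
      \/ i < 4 /\ target (nth g1 [:: g1; g2; g3; g4] i) v.
    case: (cover v) => [|[]gv|[]gv].
    + rewrite !mem_cat => /or4P[] gv;
        [exists 0 | exists 1 | exists 2 | exists 3]; by left.
    + by exists 0; right.
    + by exists 1; right.
    + by exists 2; right.
    + by exists 3; right.
  (* Indices from 4 on yield the default [g1], which is entry 0. *)
  have [i4|i4] := ltnP i 4; last first.
    exists ord0; rewrite gE; case: gi => [gi|[]]; last by rewrite ltnNge i4.
    by left; rewrite nth_default in gi.
  exists (Ordinal i4); rewrite gE /=.
  by case: gi => [|[]]; [left|right].
Qed.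

(** * Partition into four squares *)

Lemma finite_set_enum (A : set nat) :
  finite_set A -> exists2 L : seq nat, uniq L & forall x, (x \in L) <-> A x.
Proof.
move=> /finite_seqP[s ->]; exists (undup s); first exact: undup_uniq.
by move=> x; rewrite mem_undup.
Qed.

Lemma eqbN (a b : bool) : (a == ~~ b) = (a != b).
Proof. by case: a b => [] []. Qed.

Lemma four_squares (c : rel nat) :
  symmetric c -> partitioned_into_squares c 4.
Proof.
move=> symc.
have cN b x y : mono c (~~ b) x y = ~~ mono c b x y.
  by rewrite /mono /=; case: (c x y) b => [] [].
have symm b := symmetric_mono b symc.
have [U npU _] := nonprincipal_extending infinite_nat.
have [i Ui] := nonprincipal_bool (limcolor c U) npU.
pose gU := generic_square symc npU npU Ui.
have sq0 : square (mono c true) [::] by [].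
pose g0 := fixed_square sq0.
pose V := [set x | limcolor c U x == ~~ i].
have [finV|infV] := pselect (finite_set V).
  have [L uniqL LV] := finite_set_enum finV.
  (* Red is [~~ i], the limit colour on [V], so the two paths become squares through [U]; the square
     [S] of colour [i] is kept as it is. *)
  have := two_paths_square L (symm (~~ i)) (symm i).
  case=> [x y|P [Q [S [pathP pathQ sqS perm]]]]; first by rewrite -{1}[i]negbK cN.
  have limL x : x \in L -> limcolor c U x == ~~ i by move=> /LV.
  have memL x : x \in L = [|| x \in P, x \in Q | x \in S].
    by rewrite -(perm_mem perm) !mem_cat.
  have := uniqL; rewrite -(perm_uniq perm) !cat_uniq has_cat negb_or.
  case/and4P=> uniqP /andP[PQ PS] uniqQ /andP[QS uniqS].
  have [|||P' [sqP' _ subP uniqP' newP]] :=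
    @path_to_square c U (~~ i) L P symc npU _ pathP.
  - by apply/allP => x xP; apply: limL; rewrite memL xP.
  - exact: uniqP.
  - by move=> x xP; rewrite memL xP.
  (* Reserving [P'] as well as [L] keeps [Q'] disjoint from [P']. *)
  have [|||Q' [sqQ' _ subQ uniqQ' newQ]] :=
    @path_to_square c U (~~ i) (L ++ P') Q symc npU _ pathQ.
  - by apply/allP => x xQ; apply: limL; rewrite memL xQ orbT.
  - exact: uniqQ.
  - by move=> x xQ; rewrite mem_cat memL xQ orbT.
  apply: (four_growing_squares (g1 := gU) (g2 := fixed_square sqP')
    (g3 := fixed_square sqQ') (g4 := fixed_square sqS) symc) => /=.
    rewrite !cat_uniq uniqP' uniqQ' uniqS has_cat negb_or /= andbT.
    have notP x : x \in L -> x \notin P -> x \notin P'.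
      by move=> xL xP; apply/negP => /newP[]; [exact/negP|rewrite xL].
    apply/andP; split.
    - apply/andP; split; apply/hasPn => x /=.
        move=> /newQ[xQ|]; last by rewrite mem_cat negb_or => /andP[].
        by apply: notP; [rewrite memL xQ orbT|exact: (hasPn PQ)].
      by move=> xS; apply: notP; [rewrite memL xS !orbT|exact: (hasPn PS)].
    - apply/hasPn => x xS; apply/negP => /newQ[xQ|].
        by have := hasPn QS _ xS; rewrite /= xQ.
      by rewrite mem_cat memL xS !orbT.
  move=> v; case: (boolP (limcolor c U v == i)) => vi.
    by apply: Or32; left.
  have : v \in L by apply/LV; rewrite /V /= eqbN.
  rewrite memL => /or3P[/subP vP|/subQ vQ|vS]; apply: Or31; rewrite !mem_cat.
  - by rewrite vP.
  - by rewrite vQ orbT.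
  - by rewrite vS !orbT.
have [W npW WV] := nonprincipal_extending infV.
have [b Wb] := nonprincipal_bool (limcolor c W) npW.
pose gW := generic_square symc npW npW Wb.
(* Its targets have both limit colours [~~ i]; they are linked through [W]-generic vertices, which
   can be taken in [V]. *)
pose gUW := generic_square symc npU npW WV.
have [bi|bi] := eqVneq b i.
  subst b.
  apply: (four_growing_squares (g1 := gU) (g2 := gW) (g3 := gUW) (g4 := g0)) => //.
  move=> v; case: (boolP (limcolor c U v == i)) => vi.
    by apply: Or32; left.
  case: (boolP (limcolor c W v == i)) => wi.
    by apply: Or32; right.
  by apply: Or33; left; rewrite /= -!eqbN in vi wi *.
have bE : b = ~~ i by apply/eqP; rewrite eqbN.
subst b.
pose Y := [set x | limcolor c U x == ~~ i /\ limcolor c W x == i].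
have cases v : [\/ limcolor c U v == i, limcolor c W v == ~~ i | Y v].
  case: (boolP (limcolor c U v == i)) => [_|vi]; first exact: Or31.
  case: (boolP (limcolor c W v == ~~ i)) => [_|wi]; first exact: Or32.
  by apply: Or33; rewrite /Y /= eqbN vi -[i]negbK eqbN.
have [finY|infY] := pselect (finite_set Y).
  have [L uniqL LY] := finite_set_enum finY.
  (* On [Y] the [U]-limit is [~~ i] and the [W]-limit is [i], so each path has an ultrafilter of its
     own colour. *)
  have := two_paths L (symm (~~ i)) (symm i).
  case=> [x y|P [Q [pathP pathQ perm]]]; first by rewrite -{1}[i]negbK cN.
  have memL x : x \in L = (x \in P) || (x \in Q).
    by rewrite -(perm_mem perm) mem_cat.
  have := uniqL; rewrite -(perm_uniq perm) cat_uniq => /and3P[uniqP PQ uniqQ].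
  have [|||P' [sqP' _ subP uniqP' newP]] :=
    @path_to_square c U (~~ i) L P symc npU _ pathP.
  - by apply/allP => x xP; have [] : Y x by apply/LY; rewrite memL xP.
  - exact: uniqP.
  - by move=> x xP; rewrite memL xP.
  have [|||Q' [sqQ' _ subQ uniqQ' newQ]] :=
    @path_to_square c W i (L ++ P') Q symc npW _ pathQ.
  - by apply/allP => x xQ; have [] : Y x by apply/LY; rewrite memL xQ orbT.
  - exact: uniqQ.
  - by move=> x xQ; rewrite mem_cat memL xQ orbT.
  apply: (four_growing_squares (g1 := gU) (g2 := gW) (g3 := fixed_square sqP')
    (g4 := fixed_square sqQ') symc) => /=.
    rewrite cat_uniq uniqP' uniqQ' andbT; apply/hasPn => x /newQ[xQ|].
      apply/negP => /newP[xP|]; last by rewrite memL xQ orbT.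
      by have := hasPn PQ _ xQ; rewrite /= xP.
    by rewrite mem_cat negb_or => /andP[].
  move=> v; have [vi|vi|/LY] := cases v.
  - by apply: Or32; left.
  - by apply: Or32; right.
  - rewrite memL => /orP[/subP vP|/subQ vQ]; apply: Or31; rewrite !mem_cat.
      by rewrite vP.
    by rewrite vQ orbT.
(* [Z]-generic vertices can be taken in [Y], so they serve both colours; the [Z]-limit of a vertex
   of [Y] decides which of the last two squares receives it. *)
have [Z npZ ZY] := nonprincipal_extending infY.
have ZU : Z [set x | limcolor c U x == ~~ i] by apply: nonprincipalS ZY => // x [].
have ZW : Z [set x | limcolor c W x == i] by apply: nonprincipalS ZY => // x [].
apply: (four_growing_squares (g1 := gU) (g2 := gW)
  (g3 := generic_square symc npU npZ ZU)
  (g4 := generic_square symc npW npZ ZW)) => // v.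
have [vi|vi|[vU vW]] := cases v.
- by apply: Or32; left.
- by apply: Or32; right.
- apply: Or33; case: (boolP (limcolor c Z v == i)) => vZ; first by right.
  by left; split; rewrite // eqbN.
Qed.

(** * Paths, squares and independent sets *)

Definition independent (T : Type) (e : rel T) (a : pred T) : Prop :=
  forall x y, a x -> a y -> ~~ e x y.

(** Two consecutive vertices outside [a] would be adjacent, so at most one vertex is skipped at a
    time and the square has an edge across the gap. *)
Lemma square_filter_path (T : Type) (e : rel T) (a : pred T) (s : seq T) :
  independent e (predC a) -> square e s -> sorted e (seq.filter a s).
Proof.
move=> ind; have main n : forall x t, size t <= n -> square e (x :: t) ->
    path e x (seq.filter a t).
  elim: n => [|n IHn] x [|y t] //; rewrite ltnS => leTn /=.
  case/andP=> /andP[xy xt] /andP[yt sq_t].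
  have sq_yt : square e (y :: t) by rewrite /= yt.
  case ay: (a y) => /=; first by rewrite xy IHn.
  case: t => [|z t] //= in leTn xt yt sq_t {sq_yt} *.
  have /andP[yz _] := yt; rewrite take0 andbT in xt.
  have -> /= : a z.
    by apply/negPn/negP => az; have := ind y z; rewrite /= ay az yz => /(_ isT isT).
  by rewrite xt IHn // ltnW.
elim: s => //= x s IHs sq_s; case: (a x) => /=; last by apply: IHs; case/andP: sq_s.
exact: main (leqnn _) _.
Qed.

(** Members of [a] are never consecutive; the induction charges the excess of one to a first vertex
    in [a]. *)
Lemma count_independent_path (T : Type) (e : rel T) (a : pred T) (s : seq T) :
  independent e a -> sorted e s -> count a s <= count (predC a) s + 1.
Proof.
move=> ind; have main t : forall x, path e x t ->
    count a (x :: t) <= count (predC a) (x :: t) + a x.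
  elim: t => [|y t IHt] x; first by rewrite /=; case: (a x).
  move=> /= /andP[xy /IHt /=]; case ax: (a x); case ay: (a y) => //=; try lia.
  by have := ind x y ax ay; rewrite xy.
by case: s => // x s /main le; apply: leq_trans le _; rewrite leq_add2l leq_b1.
Qed.

(** Each member of [a] is followed by two vertices outside [a], unless the list ends first; hence
    the [+ 2]. *)
Lemma count_independent_square (T : Type) (e : rel T) (a : pred T) (s : seq T) :
  independent e a -> square e s -> 2 * count a s <= count (predC a) s + 2.
Proof.
move=> ind; have [n] := ubnP (size s); elim: n s => // n IHn [|x s] //.
rewrite ltnS => lesn sq_s; have /andP[xs sq_s'] := sq_s.
case ax: (a x); last by have := IHn s lesn sq_s'; rewrite /= ax /=; lia.
have indx y : e x y -> a y = false.
  by move=> xy; apply/negbTE/negP => /(ind x y ax); rewrite xy.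
case: s => [|y [|z s]] in lesn sq_s xs sq_s' *.
- by rewrite /= ax.
- by move: xs; rewrite /= andbT ax => /indx ->.
move: xs; rewrite /= take0 /= andbT ax => /andP[/indx -> /indx ->] /=.
have /andP[_ /andP[_ sq_s'']] := sq_s'.
by have := IHn s (ltnW (ltnW lesn)) sq_s''; lia.
Qed.

(** * The block colouring *)

Definition block (x : nat) : nat :=
  if x < 5 then 0 else if x < 8 then 1 else if x < 9 then 2 else 3.

(** Colour 1 means staying in one block, and every edge touching the infinite block is flipped. *)
Definition block_coloring : rel nat :=
  [rel x y | (block x == block y) (+) ((8 < x) || (8 < y))].

Lemma symmetric_block_coloring : symmetric block_coloring.
Proof. by move=> x y; rewrite /block_coloring /= eq_sym orbC. Qed.

Definition block_count (l : nat) (s : seq nat) : nat :=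
  count (fun x => block x == l) s.

(* The two cases describe the traces on {0,..,8} of squares of colour 0 and 1. *)
Definition sparse (s : seq nat) : Prop :=
  [/\ 2 * block_count 0 s <= block_count 1 s + block_count 2 s + 2
    & block_count 1 s <= block_count 2 s + 1]
  \/ exists l, forall k, k != l -> block_count k s = 0.

(** Below 9, colour 1 never leaves a block. *)
Lemma sparse_path (s : seq nat) :
  {in s, forall x, x < 9} -> sorted (mono block_coloring true) s -> sparse s.
Proof.
move=> small path_s; right.
suff [l ls] : exists l, {in s, forall x, block x = l}.
  exists l => k kl; apply/eqP; rewrite -leqn0 leqNgt -has_count.
  by apply/hasPn => x /ls ->; rewrite eq_sym.
case: s small path_s => [|x s] small path_s; first by exists 0.
exists (block x) => y; move: path_s; rewrite /=.
elim: s x small y => [|z s IHs] x small y /=; first by rewrite inE => _ /eqP->.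
case/andP=> xz path_s; rewrite inE => /orP[/eqP->//|ys].
have xzE : block x = block z.
  move: xz; rewrite /mono /block_coloring /=.
  have [x9 z9] : x < 9 /\ z < 9 by split; apply: small; rewrite !inE eqxx ?orbT.
  by rewrite [8 < x]ltnNge [8 < z]ltnNge -ltnS x9 -ltnS z9 addbF eqb_id => /eqP.
by rewrite xzE; apply: IHs path_s ys => w ws; apply: small; rewrite inE ws orbT.
Qed.

Lemma independent_block (l : nat) (a : pred nat) :
  l < 3 -> (forall x, a x -> block x = l) ->
  independent (mono block_coloring false) a.
Proof.
move=> l3 al; have lt9 z : block z = l -> (8 < z) = false.
  rewrite /block; do 2 (case: ifP => [?|_]; first by lia).
  by case: ifP => [?|_ l_eq]; [lia|rewrite -l_eq in l3].
move=> x y /al xl /al yl.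
by rewrite /mono /block_coloring /= xl yl eqxx !lt9.
Qed.

(** Finite blocks are independent in colour 0. For block 0 this gives the first bound; deleting
    block 0 leaves a path, where block 1 gives the second. *)
Lemma sparse_square (s : seq nat) :
  {in s, forall x, x < 9} -> square (mono block_coloring false) s -> sparse s.
Proof.
move=> small sq_s; left.
have count12 : count (predC (fun x => block x == 0)) s =
    block_count 1 s + block_count 2 s.
  rewrite /block_count -(count_predUI (fun x => block x == 1)).
  rewrite [X in _ + X](@eq_count _ _ pred0) ?count_pred0 ?addn0; last first.
    by move=> x /=; case: (block x) => [|[|[]]].
  apply: eq_in_count => x /small x9; rewrite /= /block.
  by case: ifP => //; case: ifP => //; rewrite x9.
split.
  rewrite -count12; apply: count_independent_square sq_s.
  by apply: (@independent_block 0) => // x /eqP.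
pose t := seq.filter (predC (fun x => block x == 0)) s.
have path_t : sorted (mono block_coloring false) t.
  apply: square_filter_path sq_s.
  by apply: (@independent_block 0) => // x /=; rewrite negbK => /eqP.
have ind1 : independent (mono block_coloring false) (fun x => block x == 1).
  by apply: (@independent_block 1) => // x /eqP.
have := count_independent_path ind1 path_t; rewrite /t !count_filter.
rewrite (@eq_count _ _ (fun x => block x == 1)); last first.
  by move=> x /=; case: (block x) => [|[]].
congr (_ <= _ + 1); apply: eq_in_count => x /small x9; rewrite /= /block.
by case: ifP => //; case: ifP => //; rewrite x9.
Qed.

Lemma injection_unbounded (g : nat -> nat) :
  injective g -> exists n, 8 < g n.
Proof.
move=> inj_g; apply: contrapT => /forallNP bnd.
have sub : {subset [seq g n | n <- iota 0 10] <= iota 0 9}.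
  move=> _ /mapP[n _ ->]; rewrite mem_iota /= add0n ltnS leqNgt.
  exact/negP/bnd.
have /uniq_leq_size/(_ sub) : uniq [seq g n | n <- iota 0 10].
  by rewrite map_inj_uniq // iota_uniq.
by rewrite size_map !size_iota.
Qed.

(** [r] is the trace on the nine small vertices. In colour 1 the larger vertices are independent, so
    deleting them leaves a path; in colour 0 no edge joins small and large, so the trace is
    everything or nothing. *)
Lemma monochromatic_square_small (p : vertex_sequence) (b : bool) :
  monochromatic_square block_coloring b p ->
  exists r, [/\ uniq r, forall x, x \in r <-> x < 9 /\ vertices p x, sparse r
    & finite_set (vertices p) \/ r = [::]].
Proof.
have sparse0 : sparse [::] by left.
have block3 z : (block z == 3) = (8 < z).
  by rewrite /block; do 3 (case: ifP => ? /=; first by lia); lia.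
have lt9 z : (z < 9) = (block z != 3) by rewrite block3 -leqNgt.
have sides x y : mono block_coloring false x y -> (x < 9) = (y < 9).
  rewrite /mono /block_coloring /= !lt9 -!block3.
  case: (eqVneq (block x) (block y)) => [->|_] //.
  by case: (block x == 3); case: (block y == 3).
have big x y : mono block_coloring true x y -> (x < 9) || (y < 9).
  rewrite /mono /block_coloring /= !lt9 -!block3 -negb_and.
  case: (eqVneq (block x) (block y)) => [->|xy]; first by case: (block y == 3).
  move=> _; apply/negP => /andP[/eqP x3 /eqP y3].
  by move: xy; rewrite x3 y3 eqxx.
case: p => [s|f] [].
  move=> uniq_s es; have sq_s : square (mono block_coloring b) s := nth_square es.
  exists (seq.filter (fun x => x < 9) s); split; last by left; exact: finite_seq.
    by rewrite filter_uniq.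
    move=> x; rewrite mem_filter; split=> [/andP[]//|[x9 xs]].
    by rewrite x9.
  have small : {in seq.filter (fun x => x < 9) s, forall x, x < 9}.
    by move=> x; rewrite mem_filter => /andP[].
  case: b sq_s {es} => sq_s.
    apply: sparse_path => //; apply: square_filter_path sq_s => x y.
    by move=> /= /negbTE x9 /negbTE y9; apply/negP => /big; rewrite x9 y9.
  have same : {in s &, forall x y, (x < 9) = (y < 9)}.
    have sq0 : sorted (mono block_coloring false) s.
      rewrite -[s]filter_predT; apply: square_filter_path sq_s.
      by move=> ? ?.
    case: s sq0 {uniq_s small sq_s} => // x s path_s.
    suff xs : {in x :: s, forall y, (y < 9) = (x < 9)}.
      by move=> y z /xs -> /xs ->.
    elim: s x path_s => [|z s IHs] x /= => [_ y|/andP[/sides xz /IHs sz] y].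
      by rewrite inE => /eqP->.
    by rewrite inE => /orP[/eqP->//|/sz ->].
  have [/hasP[x xs x9]|/hasPn nos] := boolP (has (fun x => x < 9) s).
    apply: sparse_square => //; rewrite (_ : seq.filter _ s = s) //.
    by apply/all_filterP/allP => y ys; rewrite (same y x).
  rewrite (_ : seq.filter _ s = [::]) //; apply/eqP.
  by rewrite -[_ == _]negbK -has_filter; apply/hasPn.
move=> inj_f ef; case: b ef => ef.
  (* [g] picks from each pair of consecutive vertices a small one if possible; a value above 8 thus
     gives a colour 1 edge between large vertices. *)
  pose g n := if f (n * 2) < 9 then f (n * 2) else f (n * 2).+1.
  have [|n] := @injection_unbounded g.
    by move=> n m; rewrite /g; do 2 case: ifP => _; move/inj_f; lia.
  rewrite /g; case: ifP => [|f1]; first lia.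
  have /big : mono block_coloring true (f (n * 2)) (f (n * 2).+1).
    by apply: ef; lia.
  by rewrite f1 /=; lia.
have [n fn] := injection_unbounded inj_f.
have side m : (f m < 9) = (f 0 < 9).
  by elim: m => // m <-; apply/esym/sides/ef; lia.
exists [::]; split=> //; last by right.
move=> x; split=> // -[x9 [m _ fm]].
by move: x9 fn; rewrite -fm side -(side n); lia.
Qed.

(** If both lists satisfy the inequalities, then [2 * 5 <= 3 + 1 + 4]. If one lies in a single
    block, the other contains two whole blocks, which neither case of [sparse] allows. *)
Lemma two_sparse (s t : seq nat) :
  sparse s -> sparse t ->
  ~ forall l, block_count l s + block_count l t = block_count l (iota 0 9).
Proof.
have split_sparse u : sparse u ->
    [\/ 2 * block_count 0 u <= block_count 1 u + block_count 2 u + 2 /\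
      block_count 1 u <= block_count 2 u + 1,
      block_count 0 u = 0 /\ block_count 1 u = 0
    | block_count 2 u = 0 /\ (block_count 0 u = 0 \/ block_count 1 u = 0)].
  case=> [[]|[l ul]]; first by constructor 1.
  case: l ul => [|[|l]] ul.
  - by constructor 3; split; [|right]; apply: ul.
  - by constructor 3; split; [|left]; apply: ul.
  - by constructor 2; split; apply: ul.
move=> /split_sparse sp_s /split_sparse sp_t counts.
have := (counts 0); have := (counts 1); have := (counts 2).
have -> : block_count 0 (iota 0 9) = 5 by [].
have -> : block_count 1 (iota 0 9) = 3 by [].
have -> : block_count 2 (iota 0 9) = 1 by [].
clear counts split_sparse.
move: (block_count 0 s) (block_count 1 s) (block_count 2 s) sp_s => a0 a1 a2.
move: (block_count 0 t) (block_count 1 t) (block_count 2 t) sp_t => b0 b1 b2.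
by case=> [[? ?]|[? ?]|[? [?|?]]]; case=> [[? ?]|[? ?]|[? [?|?]]]; lia.
Qed.

Lemma block_coloring_not_partitioned :
  ~ partitioned_into_squares block_coloring 3.
Proof.
case=> P [monoP disjP coverP].
have small i : exists r, [/\ uniq r,
    forall x, x \in r <-> x < 9 /\ vertices (P i) x, sparse r
    & finite_set (vertices (P i)) \/ r = [::]].
  by have [b /monochromatic_square_small] := monoP i.
have [r rP] := choice small.
(* If no trace were empty, all three parts would be finite. *)
have [i0 r0] : exists i, r i = [::].
  apply: contrapT => /forallNP nr; apply: infinite_nat.
  rewrite -coverP; apply: bigcup_finite => // i _.
  by have [_ _ _ [//|ri]] := rP i; case: (nr i).
have disj i j x : x \in r i -> x \in r j -> i = j.
  have [_ ri _ _] := rP i; have [_ rj _ _] := rP j.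
  by move=> /ri[_ xi] /rj[_ xj]; apply: disjP => //; exists x.
pose o k : 'I_3 := inord k.
have ord_neq k l : k < 3 -> l < 3 -> k != l -> o k != o l.
  by move=> k3 l3; apply: contraNneq => /(congr1 val); rewrite /= !inordK // => ->.
have has_disj k l : k < 3 -> l < 3 -> k != l -> ~~ has [in r (o k)] (r (o l)).
  move=> k3 l3 /(ord_neq _ _ k3 l3) kl; apply/hasPn => x xl; apply/negP => xk.
  by move: kl; rewrite (disj _ _ _ xk xl) eqxx.
have perm : perm_eq (r (o 0) ++ r (o 1) ++ r (o 2)) (iota 0 9).
  apply: uniq_perm; last 1 first.
  - move=> x; rewrite !mem_cat mem_iota /= add0n; apply/idP/idP.
      by case/or3P => xr; [have [_ H _ _] := rP (o 0)
        | have [_ H _ _] := rP (o 1) | have [_ H _ _] := rP (o 2)];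
        have [] := (H x).1 xr.
    move=> x9; have [i _ xi] : (\bigcup_i vertices (P i)) x by rewrite coverP.
    have xr : x \in r i by have [_ H _ _] := rP i; apply/H.
    have iE : i = o i by apply: val_inj; rewrite /= inordK.
    move: xr; rewrite iE; case: (i : nat) (ltn_ord i) => [|[|[|k]]] //= _ ->;
      by rewrite ?orbT.
  - rewrite !cat_uniq has_cat !negb_or !has_disj //.
    by have [-> _ _ _] := rP (o 0); have [-> _ _ _] := rP (o 1);
      have [-> _ _ _] := rP (o 2).
  - exact: iota_uniq.
have counts l : block_count l (r (o 0)) + (block_count l (r (o 1))
    + block_count l (r (o 2))) = block_count l (iota 0 9).
  by rewrite /block_count -(permP perm) !count_cat.
have sp i : sparse (r i) by have [] := rP i.
have i0E : i0 = o i0 by apply: val_inj; rewrite /= inordK.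
move: r0 counts; rewrite i0E; case: (i0 : nat) (ltn_ord i0) => [|[|[|k]]] // _ ->.
- by apply: two_sparse.
- by apply: two_sparse.
- by move=> counts; apply: two_sparse (sp (o 0)) (sp (o 1)) _ => l; rewrite -counts addn0.
Qed.

Theorem theorem4p7 :
  (forall c : rel nat, symmetric c ->
     exists k, k <= 4 /\ partitioned_into_squares c k)
  /\
  (exists c : rel nat, symmetric c /\ ~ partitioned_into_squares c 3).
Proof.
split=> [c symc|]; first by exists 4; split=> //; apply: four_squares.
exists block_coloring; split; first exact: symmetric_block_coloring.
exact: block_coloring_not_partitioned.
Qed.
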